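(* Let $\Omega=[0,1]$, $0<\alpha<1$, $c\in\mathbb{R}$, $g\in C(\Omega)$, $k\in C(\Omega\times\Omega)$, and let $f:\Omega\times\mathbb{R}\to\mathbb{R}$ be continuous and satisfy the Lipschitz condition $|f(x,y_2)-f(x,y_1)|\le L_f|y_2-y_1|$ for all $x\in\Omega$ and $y_1,y_2\in\mathbb{R}$, where $L_f$ is a positive constant. Let $\mathcal{M}_k:=\max_{x,t\in\Omega}|k(x,t)|$. If $$L_f\,\mathcal{M}_k<\Gamma(\alpha+1),$$ then the equation $$y(x)=\widetilde{g}(x)+\int_0^x(x-t)^{\alpha-1}(\widetilde{K}y)(t)\,dt,\qquad x\in\Omega,$$ has a unique continuous solution $y$ on $\Omega$, where $$(\widetilde{K}y)(x)=\frac{1}{\Gamma(\alpha)}\int_0^1 k(x,z)f(z,y(z))\,dz,\qquad \widetilde{g}(x)=c+\frac{1}{\Gamma(\alpha)}\int_0^x(x-t)^{\alpha-1}g(t)\,dt.$$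
   Context: This integral equation is the equivalent form of the fractional Fredholm integro-differential problem $D_{*0}^{\alpha}y(x)=g(x)+\int_0^1k(x,t)f(t,y(t))\,dt$, $y(0)=c$, where $D_{*0}^{\alpha}$ is the Caputo derivative of order $\alpha$. $\Gamma$ is the Gamma function. *)

(* Defs.v *)
From HB Require Import structures.
From mathcomp Require Import all_boot all_order all_algebra.
From mathcomp Require Import all_classical all_reals all_analysis.

Set Implicit Arguments.
Unset Strict Implicit.
Unset Printing Implicit Defensive.

Import Order.TTheory GRing.Theory Num.Theory.
Import numFieldNormedType.Exports.

Local Open Scope classical_set_scope.
Local Open Scope ring_scope.

(* Functions on [0, 1] are total functions on R; only their values on [0, 1]
   are constrained or used. All integrals are real-valued Lebesgue integrals.
   The point t = x, where the kernel (x - t)^(alpha - 1) is singular, is a null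
   set, so the value 0 `^ (alpha - 1) = 0 of the library does not matter. *)

Definition unit_itv (R : realType) : set R := `[0, 1].

(* Euler's integral; the Gamma function for s > 0 only. *)
Definition Gamma (R : realType) (s : R) : R :=
  \int[lebesgue_measure]_(t in `]0, +oo[) (t `^ (s - 1) * expR (- t)).

(* The supremum is a maximum for k continuous on the square: see max_normP. *)
Definition max_norm (R : realType) (k : R -> R -> R) : R :=
  sup [set `|k p.1 p.2| | p in @unit_itv R `*` @unit_itv R].

Lemma max_normP (R : realType) (k : R -> R -> R) :
  {within @unit_itv R `*` @unit_itv R, continuous (fun p : R * R => k p.1 p.2)} ->
  (exists x t, [/\ unit_itv x, unit_itv t & `|k x t| = max_norm k]) /\
  (forall x t, unit_itv x -> unit_itv t -> `|k x t| <= max_norm k).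
Proof.
move=> ck; set A := _ `*` _ in ck.
have A0 : A (0, 0) by split; rewrite /= /unit_itv /= in_itv /= lexx ler01.
have cA : compact A by apply: compact_setX; exact: segment_compact.
have cn : {within A, continuous (fun p : R * R => `|k p.1 p.2|)}.
  by move=> p; apply: cvg_norm; exact: ck.
have [[a b] /set_mem [/= aI bI] abmax] :=
  compact_EVT_max (ex_intro _ (0, 0) A0) cA cn.
have ubA : ubound [set `|k p.1 p.2| | p in A] `|k a b|.
  by move=> _ [p Ap <-]; apply: abmax; exact/mem_set.
have supE : `|k a b| = max_norm k.
  apply/eqP; rewrite eq_le; apply/andP; split.
  - by apply: ub_le_sup; [exists `|k a b| | exists (a, b)].
  - by apply: ge_sup => //; exists `|k 0 0|, (0, 0).
split; first by exists a, b.
by move=> x t xI tI; rewrite -supE; apply: ubA; exists (x, t).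
Qed.

Definition Ktilde (R : realType) (alpha : R) (k f : R -> R -> R) (y : R -> R)
    (x : R) : R :=
  (Gamma alpha)^-1 *
  \int[lebesgue_measure]_(z in @unit_itv R) (k x z * f z (y z)).

Definition gtilde (R : realType) (alpha c : R) (g : R -> R) (x : R) : R :=
  c + (Gamma alpha)^-1 *
  \int[lebesgue_measure]_(t in `[0, x]) ((x - t) `^ (alpha - 1) * g t).

Definition continuous_solution (R : realType) (alpha c : R) (g : R -> R)
    (k f : R -> R -> R) (y : R -> R) : Prop :=
  {within @unit_itv R, continuous y} /\
  forall x, unit_itv x ->
    y x = gtilde alpha c g x +
      \int[lebesgue_measure]_(t in `[0, x])
        ((x - t) `^ (alpha - 1) * Ktilde alpha k f y t).

(* Main.v *)
(* The right-hand side of the equation is a map Phi that sends continuous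
   functions to continuous functions: for h measurable with |h| <= H, the Abel
   integral x |-> int_0^x (x - t)^(alpha - 1) h(t) dt is Hoelder continuous of
   exponent alpha with constant 2 H / alpha. Since int_0^x (x - t)^(alpha - 1) dt
   = x^alpha / alpha <= 1 / alpha and alpha Gamma(alpha) = Gamma(alpha + 1), Phi
   is a contraction of ratio L_f M_k / Gamma(alpha + 1) < 1 for the supremum
   norm, so that Picard iteration converges uniformly to its only fixed point. *)

Require Import Defs.
From mathcomp Require Import all_boot all_order all_algebra.
From mathcomp Require Import all_classical all_reals all_analysis.
From mathcomp Require Import measurable_realfun ring lra.

Set Implicit Arguments.
Unset Strict Implicit.
Unset Printing Implicit Defensive.

Import Order.TTheory GRing.Theory Num.Theory.
Import numFieldNormedType.Exports.

Local Open Scope classical_set_scope.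
Local Open Scope ring_scope.

(** * Calculus on segments and the functional equation of the Gamma function *)

(** Supplies the form of differentiability that integration by parts and the fundamental theorem of
    calculus ask for. *)
Lemma derivable_segment_LRcontinuous (R : realType) (F : R -> R) (a b : R) :
  (forall x, a <= x <= b -> derivable F x 1) -> a <= b ->
  derivable_oo_LRcontinuous F a b.
Proof.
move=> dF ab.
have cF x : a <= x <= b -> {for x, continuous F}.
  by move=> /dF dFx; apply/differentiable_continuous/derivable1_diffP.
split.
- by move=> x; rewrite in_itv/= => /andP[ax xb]; apply: dF; rewrite !ltW.
- by apply: cvg_at_right_filter; apply: cF; rewrite lexx.
- by apply: cvg_at_left_filter; apply: cF; rewrite lexx ab.
Qed.

Lemma continuous_powR_gt0 (R : realType) (s x : R) :
  0 < x -> {for x, continuous (@powR R ^~ s)}.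
Proof.
move=> x0; apply/differentiable_continuous/derivable1_diffP.
by apply: derivable_powR; rewrite in_itv/= x0.
Qed.

Lemma measurable_powR_expRN (R : realType) (s : R) (D : set R) :
  measurable_fun D (fun t : R => t `^ s * expR (- t)).
Proof.
apply: measurable_funM.
  by apply: measurable_funTS; exact: measurable_powR.
by apply: measurable_funTS; apply: measurableT_comp.
Qed.

(** Integration by parts with the primitive -exp(-t) of exp(-t); [0 < a] keeps the segment away from
    0, where t^s need not be differentiable. *)
Lemma powR_expRN_parts (R : realType) (s a b : R) : 0 < a -> a < b ->
  (\int[lebesgue_measure]_(t in `[a, b]) (t `^ s * expR (- t))%:E =
   (a `^ s * expR (- a) - b `^ s * expR (- b))%:E +
   s%:E * \int[lebesgue_measure]_(t in `[a, b]) (t `^ (s - 1) * expR (- t))%:E)%E.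
Proof.
move=> a0 ab.
have pos x : a <= x -> 0 < x by exact: lt_le_trans.
have dN (x : R) : is_derive x 1 (fun t => - expR (- t)) (expR (- x)).
  by apply: is_derive_eq; rewrite mulrN1 opprK.
have cE (x : R) : {for x, continuous (fun t : R => expR (- t))}.
  by apply: continuous_comp; [exact: continuousN|exact: continuous_expR].
have cP r : {within `[a, b], continuous (@powR R ^~ r)}.
  apply: continuous_in_subspaceT => x; rewrite inE/= in_itv/= => /andP[ax _].
  exact/continuous_powR_gt0/pos.
have cwE : {within `[a, b], continuous (fun t : R => expR (- t))}.
  exact: continuous_subspaceT.
rewrite (@integration_by_parts R (@powR R ^~ s) (fun t => - expR (- t))
  (fun t => s * t `^ (s - 1)) (fun t => expR (- t)))//; last first.
- by move=> x _; rewrite derive1E derive_val.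
- apply: derivable_segment_LRcontinuous; last exact: ltW.
  by move=> x _; case: (dN x).
- move=> x; rewrite in_itv/= => /andP[/ltW/pos x0 _].
  by rewrite powR_derive1// in_itv/= x0.
- apply: derivable_segment_LRcontinuous; last exact: ltW.
  by move=> x /andP[/pos x0 _]; apply: derivable_powR; rewrite in_itv/= x0.
- move=> x; apply: cvgM; first exact: cvg_cst.
  exact: cP.
rewrite !mulrN opprK [(- _ + _)%R]addrC; congr (_ + _)%E.
under eq_integral do rewrite mulrN -mulrA -mulNr EFinM.
rewrite integralZl//; first by rewrite EFinN mulNe oppeK.
apply: continuous_compact_integrable; first exact: segment_compact.
by move=> x; apply: cvgM; [exact: cP|exact: cwE].
Qed.

(** For a natural m >= s, the exponential series gives exp x >= x^(m+1) / (m+1)!, which beats x^s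
    and leaves a factor 1/x. *)
Lemma cvg_powR_expRN_at_infty (R : realType) (s : R) :
  (n.+1%:R : R) `^ s * expR (- n.+1%:R) @[n --> \oo] --> 0.
Proof.
have [m sm] : exists m : nat, s <= m%:R.
  by exists (Num.truncn s).+1; exact/ltW/truncnS_gt.
apply: (@squeeze_cvgr _ _ _ _ (fun=> 0) (fun n => (m.+1)`!%:R * n.+1%:R^-1)).
- near=> n; apply/andP; split; first by rewrite mulr_ge0 ?powR_ge0 ?expR_ge0.
  rewrite expRN ler_pdivrMr ?expR_gt0// mulrAC ler_pdivlMr ?ltr0n//.
  apply: (@le_trans _ _ (n.+1%:R ^+ m.+1)).
    rewrite exprSr ler_pM2r ?ltr0n// -powR_mulrn//.
    by apply: ler_powR => //; rewrite ler1n.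
  rewrite mulrC -ler_pdivrMr ?ltr0n ?fact_gt0//.
  by apply: le_trans (expR_ge1Dxn m (ler0n _ _)); rewrite lerDr.
- exact: cvg_cst.
- rewrite -[X in _ --> X](mulr0 (m.+1)`!%:R).
  by apply: cvgM; [exact: cvg_cst|exact: cvg_harmonic].
Unshelve. all: by end_near. Qed.

Lemma cvg_powR_expRN_at_0 (R : realType) (s : R) : 0 < s ->
  (n.+1%:R^-1 : R) `^ s * expR (- n.+1%:R^-1) @[n --> \oo] --> 0.
Proof.
move=> s0.
apply: (@squeeze_cvgr _ _ _ _ (fun=> 0) (fun n => (n.+1%:R^-1 : R) `^ s)).
- near=> n; rewrite mulr_ge0 ?powR_ge0 ?expR_ge0//=.
  by rewrite ler_piMr ?powR_ge0// expR_le1 oppr_le0.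
- exact: cvg_cst.
- apply: (cvg_at_rightP _ _ _).1 (powR_cvg0 s0) _ _; split.
    by move=> n; rewrite invr_gt0 ltr0n.
  exact: cvg_harmonic.
Unshelve. all: by end_near. Qed.

(** Integration by parts on the segments [1/(n+1), n+1], which exhaust the half-line: the boundary
    terms vanish in the limit and monotone convergence handles the integrals. *)
Lemma GammaS (R : realType) (s : R) : 0 < s -> Gamma (s + 1) = s * Gamma s.
Proof.
move=> s0.
pose F (n : nat) : set R := `[(n.+1%:R^-1 : R), n.+1%:R]%classic.
have UF : \bigcup_n F n = `]0, +oo[%classic.
  apply/seteqP; split => [x [n _]|x]; rewrite /F /= !in_itv/= ?andbT.
    by move=> /andP[+ _]; apply: lt_le_trans; rewrite invr_gt0 ltr0n.
  (* A single n above x + 1/x exceeds both x and 1/x. *)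
  move=> x0; pose n := Num.bound (x + x^-1).
  have xn : x + x^-1 < n%:R by apply: archi_boundP; rewrite addr_ge0 ?invr_ge0 // ltW.
  have nS : (n%:R : R) <= n.+1%:R by rewrite ler_nat.
  have x'0 : 0 < x^-1 by rewrite invr_gt0.
  exists n => //=; rewrite in_itv/= invf_ple // ?posrE ?ltr0n//; apply/andP; split; lra.
have ndF : nondecreasing_seq F.
  move=> m n mn; rewrite subsetEset => x; rewrite /F /= !in_itv/= => /andP[h1 h2].
  apply/andP; split.
    by apply: le_trans h1; rewrite lef_pV2 ?posrE ?ltr0n// ler_nat.
  by apply: (le_trans h2); rewrite ler_nat.
have cv r : (\int[lebesgue_measure]_(t in F n) (t `^ r * expR (- t))%:E @[n --> \oo] -->
    \int[lebesgue_measure]_(t in `]0%R, +oo[) (t `^ r * expR (- t))%:E)%E.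
  rewrite -UF; apply: ge0_nondecreasing_set_cvg_integral => //.
  - by move=> n; rewrite /F.
  - by move=> n; apply/measurable_EFinP; exact: measurable_powR_expRN.
  - by move=> n x _; rewrite lee_fin mulr_ge0 ?powR_ge0 ?expR_ge0.
have E : (\int[lebesgue_measure]_(t in `]0%R, +oo[) (t `^ s * expR (- t))%:E =
    s%:E * \int[lebesgue_measure]_(t in `]0%R, +oo[) (t `^ (s - 1) * expR (- t))%:E)%E.
  apply: cvg_unique (cv s) _ => //=.
  pose r n : R := n.+1%:R^-1 `^ s * expR (- n.+1%:R^-1) -
                 n.+1%:R `^ s * expR (- n.+1%:R).
  have r0 : (r n)%:E @[n --> \oo] --> 0%E.
    apply: cvg_EFin; first exact: nearW.
    rewrite -[X in _ --> X](subrr 0); apply: cvgB.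
      exact: cvg_powR_expRN_at_0.
    exact: cvg_powR_expRN_at_infty.
  rewrite -[X in _ --> X]add0e.
  have s_fin : s%:E \is a fin_num by [].
  apply: cvg_trans; last first.
    (* The boundary terms have the finite limit 0, so the sum of the limits is well defined in the
       extended reals. *)
    by apply: cvgeD r0 (cvgeZl s_fin (cv (s - 1))); rewrite fin_num_adde_defr.
  apply: near_eq_cvg; near=> n.
  (* For n = 0 the segment is the point 1, while integration by parts was stated for [a < b]. *)
  have n_gt0 : (0 < n)%N by near: n; exists 1%N.
  have lt_inv : (n.+1%:R^-1 : R) < n.+1%:R.
    by rewrite (@lt_trans _ _ 1) ?invf_lt1 ?ltr0n ?ltr1n.
  by rewrite [RHS]powR_expRN_parts ?invr_gt0 ?ltr0n.
(* Valid for I = +oo as well, because fine +oo = 0. *)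
have fineZ (I : \bar R) : (0 <= I)%E -> fine (s%:E * I)%E = s * fine I.
  by case: I => [x||] // _; rewrite gt0_muley ?lte_fin//= mulr0.
rewrite /Gamma /Rintegral addrK E fineZ//.
by apply: integral_ge0 => x _; rewrite lee_fin mulr_ge0 ?powR_ge0 ?expR_ge0.
Unshelve. all: by end_near. Qed.

(** * The Abel kernel: integrals, integrability and Hoelder continuity *)

Lemma measurable_abel_kernel (R : realType) (s x : R) (D : set R) :
  measurable_fun D (fun t : R => (x - t) `^ s).
Proof.
apply: measurable_funTS.
apply: (measurableT_comp (measurable_powR s)).
by apply: measurable_funB.
Qed.

Lemma continuous_abel_kernel (R : realType) (s x t : R) : t < x ->
  {for t, continuous (fun t : R => (x - t) `^ s)}.
Proof.
move=> tx; apply: (@continuous_comp _ _ _ (fun t => x - t) (@powR R ^~ s)).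
  by apply: continuousB; [exact: cvg_cst|exact: cvg_id].
by apply: continuous_powR_gt0; rewrite subr_gt0.
Qed.

(** The primitive is -(x - t)^alpha / alpha; [b < x] keeps the segment away from the singularity at
    t = x. *)
Lemma abel_kernel_FTC2 (R : realType) (alpha a b x : R) :
  alpha != 0 -> a < b -> b < x ->
  (\int[lebesgue_measure]_(t in `[a, b]) ((x - t) `^ (alpha - 1))%:E =
   (((x - a) `^ alpha - (x - b) `^ alpha) / alpha)%:E)%E.
Proof.
move=> alpha0 ab bx.
pose F (t : R) := - alpha^-1 * (x - t) `^ alpha.
have dF t : t < x -> is_derive t 1 F ((x - t) `^ (alpha - 1)).
  move=> tx; have xt : 0 < x - t by rewrite subr_gt0.
  have dg := is_deriveB (is_derive_cst x t 1) (is_derive_id t 1).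
  rewrite sub0r in dg.
  have dp := @is_derive1_comp _ (@powR R ^~ alpha) (cst x - id) _ _ _
    (is_derive1_powR alpha xt) dg.
  have -> : (x - t) `^ (alpha - 1) =
      - alpha^-1 *: (alpha * (x - t) `^ (alpha - 1) * -1).
    by rewrite mulrN1 scalerN scaleNr opprK [RHS]mulKf.
  exact: is_deriveZ dp.
rewrite (@continuous_FTC2 _ _ F)//.
- by rewrite /F -EFinB; congr EFin; field.
- apply: continuous_in_subspaceT => t; rewrite inE/= in_itv/= => /andP[_ tb].
  by apply: continuous_abel_kernel; exact: le_lt_trans bx.
- apply: derivable_segment_LRcontinuous; last exact: ltW.
  by move=> t /andP[_ tb]; case: (dF t (le_lt_trans tb bx)).
- move=> t; rewrite in_itv/= => /andP[_ tb].
  by have [_ <-] := dF t (lt_trans tb bx); rewrite derive1E.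
Qed.

(** Monotone convergence along [a, x - (x - a)/(n+1)], which exhausts [a, x[; the omitted endpoint
    is a null set, and the leftover term of the primitive tends to 0 because [0 < alpha]. *)
Lemma integral_abel_kernel (R : realType) (alpha a x : R) :
  0 < alpha -> a <= x ->
  (\int[lebesgue_measure]_(t in `[a, x]) ((x - t) `^ (alpha - 1))%:E =
   ((x - a) `^ alpha / alpha)%:E)%E.
Proof.
move=> alpha0; rewrite le_eqVlt => /predU1P[->|ax].
  by rewrite set_itv1 integral_set1 subrr powR0 ?gt_eqF// mul0r.
pose F (n : nat) : set R := `[a, x - (x - a) / n.+1%:R]%classic.
have xa : 0 < x - a by rewrite subr_gt0.
have UF : \bigcup_n F n = `[a, x[%classic.
  apply/seteqP; split => [t [n _]|t]; rewrite /F /= !in_itv/=.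
    move=> /andP[-> h] /=; apply: le_lt_trans h _.
    by rewrite ltrBlDr ltrDl divr_gt0.
  move=> /andP[le_at tx]; have xt : 0 < x - t by rewrite subr_gt0.
  (* This n satisfies (x - a)/(n+1) <= x - t, which places t in the segment. *)
  exists (Num.truncn ((x - a) / (x - t))) => //=; rewrite in_itv/= le_at/=.
  rewrite lerBrDr -lerBrDl ler_pdivrMr// mulrC -ler_pdivrMr//.
  exact/ltW/truncnS_gt.
have ndF : nondecreasing_seq F.
  move=> m n mn; rewrite subsetEset => t; rewrite /F /= !in_itv/= => /andP[-> h]/=.
  apply: (le_trans h); rewrite lerD2l lerN2 ler_pM2l// lef_pV2 ?posrE ?ltr0n//.
  by rewrite ler_nat.
rewrite -integral_itv_bndo_bndc; last first.
  by apply/measurable_EFinP; exact: measurable_abel_kernel.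
rewrite -UF.
have cv : (\int[lebesgue_measure]_(t in F n) ((x - t) `^ (alpha - 1))%:E
    @[n --> \oo] -->
    \int[lebesgue_measure]_(t in \bigcup_n F n) ((x - t) `^ (alpha - 1))%:E)%E.
  apply: ge0_nondecreasing_set_cvg_integral => //.
  - by move=> n; rewrite /F.
  - by move=> n; apply/measurable_EFinP; exact: measurable_abel_kernel.
  - by move=> n t _; rewrite lee_fin powR_ge0.
apply: cvg_unique cv _ => //=.
have r0 : ((x - a) / n.+1%:R) `^ alpha @[n --> \oo] --> 0.
  apply: (cvg_at_rightP _ _ _).1 (powR_cvg0 alpha0) _ _; split.
    by move=> n; rewrite divr_gt0.
  rewrite -[X in _ --> X](mulr0 (x - a)).
  by apply: cvgM; [exact: cvg_cst|exact: cvg_harmonic].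
apply: (@cvg_trans _ ((((x - a) `^ alpha - ((x - a) / n.+1%:R) `^ alpha) / alpha)%:E
    @[n --> \oo])).
  apply: near_eq_cvg; near=> n.
  (* For n = 0 the segment shrinks to the point a, which [abel_kernel_FTC2] excludes. *)
  have n_gt0 : (0 < n)%N by near: n; exists 1%N.
  rewrite [RHS](@abel_kernel_FTC2 R) ?gt_eqF//.
  - by rewrite subKr.
  - rewrite ltrBrDr -ltrBrDl ltr_pdivrMr// ltr_pMr// ltr1n ltnS//.
  - by rewrite ltrBlDr ltrDl divr_gt0.
apply: cvg_EFin; first exact: nearW.
rewrite -[X in X / alpha]subr0.
by apply: cvgM; [apply: cvgB; [exact: cvg_cst|]|exact: cvg_cst].
Unshelve. all: by end_near. Qed.

Lemma integrable_abel_kernel (R : realType) (alpha a b x : R) :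
  0 < alpha -> a <= x -> b <= x ->
  lebesgue_measure.-integrable `[a, b]
    (EFin \o (fun t : R => (x - t) `^ (alpha - 1))).
Proof.
move=> alpha0 ax bx.
have sub : `[a, b] `<=` `[a, x] by apply: subset_itvl; rewrite bnd_simp.
apply: (@integrableS _ _ _ lebesgue_measure `[a, x]) => //; apply/integrableP; split.
  by apply/measurable_EFinP; exact: measurable_abel_kernel.
under eq_integral do rewrite /= ger0_norm ?powR_ge0//.
by rewrite integral_abel_kernel// ltry.
Qed.

(** Difference of the full integrals over [a, x] and [b, x], so that b may reach the singular point
    x. *)
Lemma Rintegral_abel_kernel (R : realType) (alpha a b x : R) :
  0 < alpha -> a <= b -> b <= x ->
  \int[lebesgue_measure]_(t in `[a, b]) ((x - t) `^ (alpha - 1)) =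
  ((x - a) `^ alpha - (x - b) `^ alpha) / alpha.
Proof.
move=> alpha0 ab bx; have ax := le_trans ab bx.
have full c : c <= x -> \int[lebesgue_measure]_(t in `[c, x])
    ((x - t) `^ (alpha - 1)) = (x - c) `^ alpha / alpha.
  by move=> cx; rewrite /Rintegral integral_abel_kernel.
have := @Rintegral_itvB R (fun t => (x - t) `^ (alpha - 1)) (BLeft a) (BRight x) b
  (integrable_abel_kernel alpha0 ax (lexx x)).
rewrite !bnd_simp => /(_ ab bx).
rewrite Rintegral_itv_obnd_cbnd; last first.
  apply: (@integrableS _ _ _ lebesgue_measure `[b, x]) => //.
    exact: subset_itv_oc_cc.
  exact: integrable_abel_kernel.
by rewrite !full// mulrBl => <-; rewrite subKr.
Qed.

Lemma integrable_abel_kernelM (R : realType) (alpha a b x H : R) (h : R -> R) :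
  0 < alpha -> a <= x -> b <= x -> measurable_fun `[a, b] h ->
  (forall t, a <= t <= b -> `|h t| <= H) ->
  lebesgue_measure.-integrable `[a, b]
    (EFin \o (fun t : R => (x - t) `^ (alpha - 1) * h t)).
Proof.
move=> alpha0 ax bx mh hH.
apply: (@integrableMl _ _ _ lebesgue_measure `[a, b] _
  (EFin \o (fun t => (x - t) `^ (alpha - 1))) h) => //.
  exact: integrable_abel_kernel.
(* Boundedness is encoded as: every y above some threshold bounds |h|. The threshold is [H]. *)
exists H; split; first exact: num_real.
by move=> y Hy t; rewrite /= in_itv => /hH /le_trans; apply; exact: ltW.
Qed.

Lemma normr_Rintegral_le {d} {T : measurableType d} (R : realType)
    (mu : {measure set T -> \bar R}) (D : set T) (f g : T -> R) :
  measurable D -> mu.-integrable D (EFin \o f) -> mu.-integrable D (EFin \o g) ->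
  (forall t, D t -> `|f t| <= g t) ->
  `|\int[mu]_(t in D) f t| <= \int[mu]_(t in D) g t.
Proof.
move=> mD fi gi fg; apply: (le_trans (le_normr_Rintegral mD fi)).
apply: le_Rintegral => //.
exact: (integrable_norm fi).
Qed.

Lemma normr_abel_le (R : realType) (alpha a b x H : R) (h : R -> R) :
  0 < alpha -> a <= b -> b <= x -> measurable_fun `[a, b] h ->
  (forall t, a <= t <= b -> `|h t| <= H) ->
  `|\int[lebesgue_measure]_(t in `[a, b]) ((x - t) `^ (alpha - 1) * h t)| <=
  H * (((x - a) `^ alpha - (x - b) `^ alpha) / alpha).
Proof.
move=> alpha0 ab bx mh hH; have ax := le_trans ab bx.
rewrite -Rintegral_abel_kernel//.
have ik := integrable_abel_kernel alpha0 ax bx.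
rewrite -RintegralZl//; apply: normr_Rintegral_le => //.
- exact: integrable_abel_kernelM hH.
- exact: integrableZl ik.
- move=> t; rewrite /= in_itv => /hH htH.
  by rewrite normrM ger0_norm ?powR_ge0// mulrC ler_wpM2r ?powR_ge0.
Qed.

Lemma abel_kernel_nonincreasing (R : realType) (alpha t x x' : R) :
  alpha <= 1 -> t < x -> x <= x' ->
  (x' - t) `^ (alpha - 1) <= (x - t) `^ (alpha - 1).
Proof.
move=> alpha1 tx xx'; rewrite -(opprB 1) !powRN.
have xt : 0 < x - t by rewrite subr_gt0.
rewrite lef_pV2 ?posrE ?powR_gt0//; last by rewrite (lt_le_trans xt)// lerD2r.
by rewrite ge0_ler_powR ?nnegrE ?subr_ge0 ?lerD2r// ?(ltW tx)// ltW// (lt_le_trans tx).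
Qed.

(** Cut [a, x'] at x. The piece over [x, x'] costs H (x' - x)^alpha / alpha. On [a, x[ the
    difference of the two kernels has constant sign, so its explicit integral bounds the rest by the
    same amount. *)
Lemma abel_hoelder (R : realType) (alpha a x x' H : R) (h : R -> R) :
  0 < alpha -> alpha <= 1 -> a <= x -> x <= x' -> measurable_fun `[a, x'] h ->
  (forall t, a <= t <= x' -> `|h t| <= H) ->
  `|\int[lebesgue_measure]_(t in `[a, x']) ((x' - t) `^ (alpha - 1) * h t) -
    \int[lebesgue_measure]_(t in `[a, x]) ((x - t) `^ (alpha - 1) * h t)| <=
  2 * H * (x' - x) `^ alpha / alpha.
Proof.
move=> alpha0 alpha1 ax xx' mh hH; have ax' := le_trans ax xx'.
have H0 : 0 <= H.
  by apply: le_trans (normr_ge0 (h a)) (hH _ _); rewrite lexx.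
have sub : `[a, x] `<=` `[a, x'] by apply: subset_itvl; rewrite bnd_simp.
have subo : `[a, x[ `<=` `[a, x] by exact: subset_itv_co_cc.
have mhx : measurable_fun `[a, x] h by exact: measurable_funS mh.
have hHx t : a <= t <= x -> `|h t| <= H.
  by move=> /andP[le_at tx]; apply: hH; rewrite le_at (le_trans tx).
have i1 : lebesgue_measure.-integrable `[a, x']
    (EFin \o (fun t : R => (x' - t) `^ (alpha - 1) * h t)).
  exact: integrable_abel_kernelM hH.
have i2 : lebesgue_measure.-integrable `[a, x]
    (EFin \o (fun t : R => (x' - t) `^ (alpha - 1) * h t)).
  exact: (@integrableS _ _ _ lebesgue_measure `[a, x']).
have i3 : lebesgue_measure.-integrable `[a, x]
    (EFin \o (fun t : R => (x - t) `^ (alpha - 1) * h t)).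
  exact: integrable_abel_kernelM hHx.
have := @Rintegral_itvB R _ (BLeft a) (BRight x') x i1.
rewrite !bnd_simp => /(_ ax xx').
rewrite Rintegral_itv_obnd_cbnd; last first.
  apply: (@integrableS _ _ _ lebesgue_measure `[a, x']) => //.
  by apply: subset_itv; rewrite bnd_simp.
move=> /(canRL (subrK _)) ->.
rewrite -addrA; apply: (le_trans (ler_normD _ _)).
have -> : 2 * H * (x' - x) `^ alpha / alpha =
  H * ((x' - x) `^ alpha / alpha) + H * ((x' - x) `^ alpha / alpha) by ring.
apply: lerD.
  apply: le_trans (normr_abel_le alpha0 xx' (lexx x') _ _) _.
  - by apply: measurable_funS mh => //; apply: subset_itvr; rewrite bnd_simp.
  - by move=> t /andP[xt tx']; apply: hH; rewrite tx' (le_trans ax).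
  - by rewrite subrr powR0 ?subr0// gt_eqF.
have ik x0 : x <= x0 -> lebesgue_measure.-integrable `[a, x]
    (EFin \o (fun t : R => (x0 - t) `^ (alpha - 1))).
  by move=> xx0; apply: integrable_abel_kernel => //; exact: le_trans xx0.
have i23 := @integrableB _ _ R lebesgue_measure `[a, x]%classic
  (measurable_itv _) _ _ i2 i3.
(* The comparison of the kernels fails at t = x, where 0 `^ (alpha - 1) = 0. *)
rewrite -RintegralB// -Rintegral_itv_bndo_bndc; last first.
  exact: (@integrableS _ _ _ lebesgue_measure `[a, x]).
(* [K] is the kernel difference, ordered so as to be nonnegative on [a, x[. *)
pose K t := (x - t) `^ (alpha - 1) - (x' - t) `^ (alpha - 1).
have iK : lebesgue_measure.-integrable `[a, x] (EFin \o K).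
  exact: (@integrableB _ _ R lebesgue_measure `[a, x]%classic (measurable_itv _) _ _
    (ik x (lexx x)) (ik x' xx')).
have bound := @normr_Rintegral_le _ _ R lebesgue_measure `[a, x[ _
   (fun t => H * K t).
apply: le_trans (bound _ _ _ _ _) _ => //.
- by apply: (@integrableS _ _ _ lebesgue_measure `[a, x]).
- apply: (@integrableS _ _ _ lebesgue_measure `[a, x]) => //.
  exact: (@integrableZl _ _ R lebesgue_measure `[a, x]%classic (measurable_itv _) H _ iK).
- move=> t; rewrite /= in_itv/= => /andP[le_at tx].
  have K0 : 0 <= K t by rewrite subr_ge0 abel_kernel_nonincreasing.
  rewrite -mulrBl normrM distrC (ger0_norm K0) mulrC.
  by apply: ler_wpM2r => //; apply: hHx; rewrite le_at ltW.
rewrite Rintegral_itv_bndo_bndc; last first.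
  apply: (@integrableS _ _ _ lebesgue_measure `[a, x]) => //.
  exact: (@integrableZl _ _ R lebesgue_measure `[a, x]%classic (measurable_itv _) H _ iK).
rewrite RintegralZl// RintegralB//; [|exact: ik..].
rewrite !Rintegral_abel_kernel// subrr powR0 ?gt_eqF// subr0.
rewrite ler_wpM2l// -mulrBl ler_wpM2r ?invr_ge0 ?(ltW alpha0)//.
(* What remains besides (x' - x)^alpha is (x - a)^alpha - (x' - a)^alpha, which is at most 0. *)
rewrite opprB addrCA gerDl subr_le0.
by rewrite ge0_ler_powR ?nnegrE ?subr_ge0 ?lerD2r// ltW.
Qed.

Lemma continuous_abel (R : realType) (alpha a b H : R) (h : R -> R) :
  0 < alpha -> alpha <= 1 -> measurable_fun `[a, b] h ->
  (forall t, a <= t <= b -> `|h t| <= H) ->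
  {within `[a, b], continuous (fun x =>
     \int[lebesgue_measure]_(t in `[a, x]) ((x - t) `^ (alpha - 1) * h t))}.
Proof.
move=> alpha0 alpha1 mh hH.
pose J x :=
  \int[lebesgue_measure]_(t in `[a, x]) ((x - t) `^ (alpha - 1) * h t).
apply/subspace_continuousP => x xab; rewrite -/J.
have HJ y z : a <= y -> y <= z -> z <= b ->
    `|J z - J y| <= 2 * H * (z - y) `^ alpha / alpha.
  move=> ay yz zb; apply: abel_hoelder => //.
    by apply: measurable_funS mh => //; apply: subset_itvl; rewrite bnd_simp.
  by move=> t /andP[le_at tz]; apply: hH; rewrite le_at (le_trans tz).
have H0 : 0 <= H.
  move: xab; rewrite /= in_itv/= => /hH; exact: le_trans.
apply/cvgrPdist_le => e e0.
(* Chosen so that r^alpha <= c forces 2 H r^alpha / alpha <= e; the radius is then c^(1/alpha). The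
   summand 1 keeps the denominator positive when [H] is 0. *)
pose c := e * alpha / (2 * H + 1).
have c0 : 0 < c by rewrite divr_gt0 ?mulr_gt0// ltr_wpDl// mulr_ge0.
have d0 : 0 < c `^ alpha^-1 by rewrite powR_gt0.
have Hd r : 0 <= r -> r <= c `^ alpha^-1 -> 2 * H * r `^ alpha / alpha <= e.
  move=> r0 rd; rewrite ler_pdivrMr//.
  have rc : r `^ alpha <= c.
    rewrite -[leRHS](powRr1 (ltW c0)) -(mulVf (lt0r_neq0 alpha0)) powRrM.
    by rewrite ge0_ler_powR ?nnegrE ?powR_ge0// ltW.
  apply: (@le_trans _ _ ((2 * H + 1) * c)).
    by rewrite ler_pM ?mulr_ge0 ?powR_ge0// lerDl.
  by rewrite /c mulrC divfK// gt_eqF// ltr_wpDl// mulr_ge0.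
rewrite near_withinE; near=> y => yab.
have xy : `|x - y| <= c `^ alpha^-1.
  by near: y; apply: (@cvgr_dist_le R R^o R (nbhs (x : R)) _ id x cvg_id).
move: xab yab; rewrite /= !in_itv/= => /andP[ax xb] /andP[ay yb].
have [le|/ltW le] := leP y x.
  apply: le_trans (HJ _ _ ay le xb) (Hd _ _ _); first lra.
  by rewrite -[leLHS]ger0_norm// subr_ge0.
rewrite distrC; apply: le_trans (HJ _ _ ax le yb) (Hd _ _ _); first lra.
by rewrite -[leLHS]ger0_norm ?subr_ge0// distrC.
Unshelve. all: by end_near. Qed.

(** * Fixed points of contractions for the uniform distance *)

Lemma expr_small (R : realType) (q B e : R) : 0 <= q -> q < 1 -> 0 < e ->
  exists n, B * q ^+ n <= e.
Proof.
move=> q0 q1 e0.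
have h : B * q ^+ n @[n --> \oo] --> (B * 0 : R).
  by apply: cvgM; [exact: cvg_cst|apply: cvg_expr; rewrite ger0_norm].
rewrite mulr0 in h.
have /cvgrPdist_le/(_ e e0)[N _ hN] := h.
exists N; have := hN N (leqnn N); rewrite sub0r normrN.
exact: le_trans (ler_norm _).
Qed.

(** Applying the contraction n times improves a bound D on the distance of two fixed points to D
    q^n. The space [T] need not be compact, so a first bound D is assumed. *)
Lemma uniform_contraction_unique (T : topologicalType) (R : realType)
    (Phi : (T -> R) -> T -> R) (q D : R) (u v : T -> R) :
  0 <= q -> q < 1 ->
  (forall u v D, continuous u -> continuous v ->
    (forall x, `|u x - v x| <= D) -> forall x, `|Phi u x - Phi v x| <= q * D) ->
  continuous u -> continuous v -> Phi u =1 u -> Phi v =1 v ->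
  (forall x, `|u x - v x| <= D) -> u =1 v.
Proof.
move=> q0 q1 lip cu cv fu fv uv x.
have uvn n y : `|u y - v y| <= D * q ^+ n.
  elim: n y => [|n IH] y; first by rewrite mulr1.
  by rewrite -fu -fv exprS mulrCA; exact: lip.
apply/eqP; rewrite -subr_eq0 -normr_le0; apply/ler_addgt0Pr => e e0.
have [n ne] := expr_small D q0 q1 e0.
by rewrite add0r; apply: le_trans ne.
Qed.

(** Banach's argument with pointwise bounds in place of a complete function space: the Picard
    iterates from 0 are Cauchy at each point, and the error bound B q^n, uniform in the point, makes
    the limit continuous and fixed. *)
Lemma uniform_contraction_fixpoint (T : topologicalType) (R : realType)
    (Phi : (T -> R) -> T -> R) (q C : R) :
  0 <= q -> q < 1 ->
  (forall u, continuous u -> continuous (Phi u)) ->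
  (forall u v D, continuous u -> continuous v ->
    (forall x, `|u x - v x| <= D) -> forall x, `|Phi u x - Phi v x| <= q * D) ->
  (forall x, `|Phi (fun=> 0) x| <= C) ->
  exists y : T -> R, continuous y /\ Phi y =1 y.
Proof.
move=> q0 q1 cPhi lip hC.
pose u n := iter n Phi (fun=> 0).
have cu n : continuous (u n).
  by elim: n => [|n IH]; [move=> x; exact: cvg_cst|exact: cPhi].
have step n x : `|u n.+1 x - u n x| <= C * q ^+ n.
  elim: n x => [|n IH] x; first by rewrite mulr1 subr0; exact: hC.
  by rewrite exprS mulrCA; exact: (lip (u n.+1) (u n) _ (cu _) (cu _) IH).
(* Sum of the geometric series of the step bounds C q^n. *)
pose B := C / (1 - q).
have q'0 : 0 < 1 - q by rewrite subr_gt0.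
have CB : C = B * (1 - q) by rewrite /B divfK// gt_eqF.
(* The exact partial geometric sum lets the induction on m close by an identity. *)
have dist n m x : `|u (n + m)%N x - u n x| <= B * (q ^+ n - q ^+ (n + m)).
  elim: m => [|m IH]; first by rewrite addn0 !subrr normr0 mulr0.
  rewrite addnS (le_trans (ler_distD (u (n + m)%N x) _ _))//.
  apply: (le_trans (lerD (step _ _) IH)).
  by rewrite le_eqVlt; apply/orP; left; apply/eqP; rewrite CB exprS; ring.
(* [T] may be empty, so nonnegativity of these bounds is drawn from a point. *)
have C0 (x : T) : 0 <= C by apply: le_trans (hC x).
have B0 (x : T) : 0 <= B by rewrite /B mulr_ge0 ?invr_ge0 ?(ltW q'0)// (C0 x).
have distB n m x : `|u (n + m)%N x - u n x| <= B * q ^+ n.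
  apply: (le_trans (dist n m x)); rewrite ler_wpM2l ?(B0 x)//.
  by rewrite gerBl exprn_ge0.
have cvgu x : cvg (u n x @[n --> \oo]).
  apply: cauchy_cvg; apply: cauchy_exP => e e0.
  have [N hN] := expr_small B q0 q1 (divr_gt0 e0 (ltr0Sn R 1)).
  exists (u N x); exists N => // n /= Nn.
  rewrite /ball /= distrC -(subnKC Nn).
  apply: le_lt_trans (distB _ _ _) _; apply: (le_lt_trans hN).
  by rewrite ltr_pdivrMr// ltr_pMr// ltr1n.
pose y x := lim (u n x @[n --> \oo]).
(* Passage to the limit m -> oo in [distB], with an arbitrary slack e. *)
have uy n x : `|y x - u n x| <= B * q ^+ n.
  apply/ler_addgt0Pr => e e0.
  have /cvgrPdist_le/(_ e e0)[N _ hN] := cvgu x.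
  have := hN (n + N)%N (leq_addl _ _); rewrite -/(y x) => h.
  apply: (le_trans (ler_distD (u (n + N)%N x) _ _)).
  by rewrite addrC lerD.
have cy : continuous y.
  move=> x; apply/cvgrPdist_le => e e0.
  (* Uniform limit of continuous functions: one third for each passage to the nth iterate, one for
     its continuity. *)
  have e3 : 0 < e / 3 by rewrite divr_gt0.
  have [n ne] := expr_small B q0 q1 e3.
  have /cvgrPdist_le/(_ _ e3) hn := cu n x.
  near=> z.
  have h1 := le_trans (uy n x) ne; have h2 := le_trans (uy n z) ne.
  have h3 : `|u n x - u n z| <= e / 3 by near: z.
  have -> : y x - y z = (y x - u n x) + (u n x - u n z) - (y z - u n z).
    by rewrite opprB !addrA !subrK.
  have -> : e = e / 3 + e / 3 + e / 3 by field.
  apply: (le_trans (ler_normB _ _)); apply: lerD h2.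
  by apply: (le_trans (ler_normD _ _)); exact: lerD.
exists y; split => // x.
apply/eqP; rewrite -subr_eq0 -normr_le0; apply/ler_addgt0Pr => e e0.
rewrite add0r.
(* Both y - u_(n+1) and its counterpart Phi y - u_(n+1) are bounded by B q^(n+1), whence the
   constant 2 q B. *)
have [n ne] := expr_small (2 * q * B) q0 q1 e0.
apply: le_trans ne.
apply: (le_trans (ler_distD (u n.+1 x) _ _)).
have h1 : `|Phi y x - u n.+1 x| <= q * (B * q ^+ n) by apply: lip.
have h2 : `|u n.+1 x - y x| <= B * q ^+ n.+1 by rewrite distrC; exact: uy.
apply: (le_trans (lerD h1 h2)).
by rewrite le_eqVlt exprS; apply/orP; left; apply/eqP; ring.
Unshelve. all: by end_near. Qed.

(** * Extension from [0, 1] to the line, and the Fredholm operator *)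

Lemma continuous_comp_within (T U V : topologicalType) (A : set U)
    (p : T -> U) (h : U -> V) :
  continuous p -> (forall x, A (p x)) -> {within A, continuous h} ->
  continuous (h \o p).
Proof.
move=> cp Ap /subspace_continuousP ch x.
apply: cvg_comp (ch _ (Ap x)) => W /cp pW.
by apply: (@filterS _ (nbhs x) _ _ _ _ pW) => y /=; apply; exact: Ap.
Qed.

Lemma continuous_pair (T U V : topologicalType) (a : T -> U) (b : T -> V) :
  continuous a -> continuous b -> continuous (fun x => (a x, b x)).
Proof. by move=> ca cb x; apply: cvg_pair; [exact: ca|exact: cb]. Qed.

(* The retraction of R onto [0, 1]: precomposing with it turns functions that
   are continuous within [0, 1] into continuous functions. *)
Definition clamp (R : realType) (x : R) : R := Num.max 0 (Num.min x 1).

Lemma clamp_itv (R : realType) (x : R) : 0 <= clamp x <= 1.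
Proof. by rewrite /clamp le_max lexx/= ge_max ler01 ge_min lexx orbT. Qed.

Lemma unit_itv_clamp (R : realType) (x : R) : unit_itv (clamp x).
Proof. by rewrite /unit_itv /= in_itv/= clamp_itv. Qed.

Lemma clamp_id (R : realType) (x : R) : unit_itv x -> clamp x = x.
Proof.
rewrite /unit_itv /= in_itv/= => /andP[x0 x1].
by rewrite /clamp (min_idPl x1) (max_idPr x0).
Qed.

Lemma continuous_clamp (R : realType) : continuous (@clamp R).
Proof.
move=> x; have c0 : {for x, continuous (fun=> 0 : R^o)} by exact: cvg_cst.
have c1 : {for x, continuous (fun=> 1 : R^o)} by exact: cvg_cst.
exact: (continuous_max c0 (continuous_min (@cvg_id _ (nbhs x)) c1)).
Qed.

Lemma continuous_bounded_unit (R : realType) (h : R -> R) :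
  continuous h -> exists H, forall t, 0 <= t <= 1 -> `|h t| <= H.
Proof.
move=> ch.
have cn : {within `[0, 1], continuous (fun t : R => `|h t|)}.
  by apply: continuous_subspaceT => t; apply: cvg_norm; exact: ch.
have [t _ tmax] := EVT_max ler01 cn.
by exists `|h t| => s s01; apply: tmax; rewrite in_itv.
Qed.

(** Continuity under the integral sign, dominated by the constant M C with C a bound of |phi| on
    [0, 1]. *)
Lemma continuous_fredholm (R : realType) (k : R -> R -> R) (phi : R -> R) (M : R) :
  (forall z, continuous (k ^~ z)) -> (forall x, continuous (k x)) ->
  (forall x z, `|k x z| <= M) ->
  continuous phi ->
  continuous (fun x => \int[lebesgue_measure]_(z in `[0, 1]) (k x z * phi z)).
Proof.
move=> ck1 ck2 kM cphi x.
have [C hC] := continuous_bounded_unit cphi.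
have h := @continuity_under_integral R _ _ lebesgue_measure
  (fun y z => k y z * phi z) `[0, 1]%classic (measurable_itv _)
  (x - 1) (x + 1) _ _ (fun=> M * C) _ _.
apply: h.
- move=> y _; apply: continuous_compact_integrable; first exact: segment_compact.
  apply: continuous_subspaceT => z; apply: cvgM; [exact: ck2|exact: cphi].
- apply: aeW => z _ y _; apply: cvgM; [exact: ck1|exact: cvg_cst].
- apply: continuous_compact_integrable; first exact: segment_compact.
  by apply: continuous_subspaceT => z; exact: cvg_cst.
- move=> y _; apply: aeW => z; rewrite /= in_itv/= => /hC hz.
  by rewrite normrM ler_pM.
- by rewrite inE/= in_itv/=; lra.
Qed.

(** * Existence and uniqueness for the integral equation *)

Theorem theorem3 (R : realType) (alpha c Lf : R) (g : R -> R)
    (k f : R -> R -> R)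
    (alpha_gt0 : 0 < alpha) (alpha_lt1 : alpha < 1)
    (g_cont : {within @unit_itv R, continuous g})
    (k_cont : {within @unit_itv R `*` @unit_itv R,
                 continuous (fun p : R * R => k p.1 p.2)})
    (f_cont : {within @unit_itv R `*` [set: R],
                 continuous (fun p : R * R => f p.1 p.2)})
    (Lf_gt0 : 0 < Lf)
    (f_lip : forall x y1 y2 : R, unit_itv x ->
       `|f x y2 - f x y1| <= Lf * `|y2 - y1|)
    (small : Lf * max_norm k < Gamma (alpha + 1)) :
  exists y : R -> R,
    continuous_solution alpha c g k f y /\
    forall z : R -> R, continuous_solution alpha c g k f z ->
      forall x : R, unit_itv x -> z x = y x.
Proof.
have [_ k_le] := max_normP k_cont.
set M := max_norm k in small k_le.
have M_ge0 : 0 <= M.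
  exact: le_trans (normr_ge0 _) (k_le _ _ (unit_itv_clamp 0) (unit_itv_clamp 0)).
have GS := GammaS alpha_gt0.
(* Positivity comes from the smallness hypothesis, 0 <= Lf M < Gamma(alpha + 1), and passes to
   Gamma(alpha) by the functional equation. *)
have GS_gt0 : 0 < Gamma (alpha + 1).
  by apply: le_lt_trans small; rewrite mulr_ge0// ltW.
have G_gt0 : 0 < Gamma alpha by rewrite GS pmulr_rgt0 in GS_gt0.
pose J (h : R -> R) x :=
  \int[lebesgue_measure]_(t in `[0, x]) ((x - t) `^ (alpha - 1) * h t).
pose K u x := (Gamma alpha)^-1 * \int[lebesgue_measure]_(z in `[0, 1])
  (k (clamp x) (clamp z) * f (clamp z) (u z)).
(* The right-hand side of the equation as a map on functions on the whole line; its value depends on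
   x only through [clamp x]. *)
pose Phi u x := c + (Gamma alpha)^-1 * J (g \o @clamp R) (clamp x) +
  J (K u) (clamp x).
have cclamp := @continuous_clamp R.
have m_cont (h : R -> R) (D : set R) : continuous h -> measurable_fun D h.
  by move=> ch; apply: measurable_funTS; exact: continuous_measurable_fun.
have J_cont h : continuous h -> continuous (J h \o @clamp R).
  move=> ch; have [H hH] := continuous_bounded_unit ch.
  apply: continuous_comp_within cclamp (@unit_itv_clamp R) _.
  by apply: continuous_abel (ltW alpha_lt1) _ hH => //; exact: m_cont.
have fu_cont u : continuous u -> continuous (fun z => f (clamp z) (u z)).
  move=> cu; apply: (@continuous_comp_within _ _ _ _ (fun z => (clamp z, u z))
    _ _ _ f_cont); first exact: continuous_pair.
  by move=> z; split => //; exact: unit_itv_clamp.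
have k1_cont z : continuous (fun x => k (clamp x) (clamp z)).
  apply: (@continuous_comp_within _ _ _ _ (fun x => (clamp x, clamp z))
    _ _ _ k_cont).
    by apply: continuous_pair => // x; exact: cvg_cst.
  by move=> x; split; exact: unit_itv_clamp.
have k2_cont x : continuous (fun z => k (clamp x) (clamp z)).
  apply: (@continuous_comp_within _ _ _ _ (fun z => (clamp x, clamp z))
    _ _ _ k_cont).
    by apply: continuous_pair => // z; exact: cvg_cst.
  by move=> z; split; exact: unit_itv_clamp.
have kM x z : `|k (clamp x) (clamp z)| <= M by apply: k_le; exact: unit_itv_clamp.
have K_cont u : continuous u -> continuous (K u).
  move=> cu x; apply: cvgM; first exact: cvg_cst.
  apply: (@continuous_fredholm _ (fun x z => k (clamp x) (clamp z))
    (fun z => f (clamp z) (u z)) M) => //.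
  exact: fu_cont.
have g_clamp_cont : continuous (g \o @clamp R).
  exact: continuous_comp_within cclamp (@unit_itv_clamp R) g_cont.
have Phi_cont u : continuous u -> continuous (Phi u).
  move=> cu x; apply: cvgD; last exact: (J_cont _ (K_cont _ cu)).
  apply: cvgD; first exact: cvg_cst.
  by apply: cvgM; [exact: cvg_cst|exact: (J_cont _ g_clamp_cont)].
have clampK x : clamp (clamp x) = clamp x by apply: clamp_id; exact: unit_itv_clamp.
have Phi_clamp u x : Phi u (clamp x) = Phi u x by rewrite /Phi clampK.
have ki_int u x : continuous u -> lebesgue_measure.-integrable `[0, 1]
    (EFin \o (fun z => k (clamp x) (clamp z) * f (clamp z) (u z))).
  move=> cu; apply: continuous_compact_integrable; first exact: segment_compact.
  apply: continuous_subspaceT => z.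
  by apply: cvgM; [exact: k2_cont|exact: fu_cont].
have K_lip u v D x : continuous u -> continuous v ->
    (forall x, `|u x - v x| <= D) ->
    `|K u x - K v x| <= (Gamma alpha)^-1 * (M * (Lf * D)).
  move=> cu cv uvD; rewrite /K -mulrBr normrM gtr0_norm ?invr_gt0//.
  rewrite ler_wpM2l ?invr_ge0 ?(ltW G_gt0)//.
  rewrite -RintegralB//; [|exact: ki_int..].
  have intE : \int[lebesgue_measure]_(z in `[0, 1]) (M * (Lf * D)) = M * (Lf * D).
    rewrite Rintegral_cst//= lebesgue_measure_itv/= lte_fin ltr01.
    by rewrite -EFinB/= subr0 mulr1.
  rewrite -[leRHS]intE.
  apply: (@normr_Rintegral_le _ _ _ lebesgue_measure) => //.
  - exact: (@integrableB _ _ R lebesgue_measure `[0, 1]%classic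
      (measurable_itv _) _ _ (ki_int u x cu) (ki_int v x cv)).
  - apply: continuous_compact_integrable; first exact: segment_compact.
    by apply: continuous_subspaceT => z; exact: cvg_cst.
  - move=> z _; rewrite -mulrBr normrM ler_pM//.
    apply: (le_trans (f_lip _ _ _ (unit_itv_clamp z))).
    by rewrite ler_pM2l.
pose q := Lf * M / Gamma (alpha + 1).
have q_ge0 : 0 <= q by rewrite divr_ge0 ?mulr_ge0 ?(ltW Lf_gt0) ?(ltW GS_gt0).
have q_lt1 : q < 1 by rewrite /q ltr_pdivrMr// mul1r.
have Phi_lip u v D : continuous u -> continuous v ->
    (forall x, `|u x - v x| <= D) -> forall x, `|Phi u x - Phi v x| <= q * D.
  move=> cu cv uvD x.
  have D_ge0 : 0 <= D by exact: le_trans (uvD 0).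
  have /andP[x0 x1] := clamp_itv x.
  have Ku := K_cont u cu; have Kv := K_cont v cv.
  have iJ w : continuous w -> lebesgue_measure.-integrable `[0, clamp x]
      (EFin \o (fun t => (clamp x - t) `^ (alpha - 1) * w t)).
    move=> cw; have [H hH] := continuous_bounded_unit cw.
    apply: (@integrable_abel_kernelM _ _ _ _ _ H) => //; first exact: m_cont.
    by move=> t /andP[t0 tx]; apply: hH; rewrite t0 (le_trans tx).
  (* The terms in c and g cancel; only the Abel integral of K u - K v remains. *)
  rewrite /Phi opprD addrACA subrr add0r /J -RintegralB//; [|exact: iJ..].
  under eq_Rintegral do rewrite -mulrBr.
  have h := @normr_abel_le _ alpha 0 (clamp x) (clamp x)
    ((Gamma alpha)^-1 * (M * (Lf * D))) (fun t => K u t - K v t) alpha_gt0 x0 (lexx _).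
  apply: le_trans (h _ _) _.
  - by apply: m_cont => t; apply: cvgB; [exact: Ku|exact: Kv].
  - by move=> t _; exact: K_lip.
  rewrite subr0 subrr powR0 ?gt_eqF// subr0.
  (* By Gamma(alpha + 1) = alpha Gamma(alpha); what is left is x^alpha <= 1 on [0, 1]. *)
  have -> : q * D = (Gamma alpha)^-1 * (M * (Lf * D)) * (1 / alpha).
    rewrite /q GS; field; by rewrite !gt_eqF.
  rewrite ler_wpM2l ?mulr_ge0 ?invr_ge0 ?(ltW G_gt0) ?(ltW Lf_gt0)//.
  rewrite ler_wpM2r ?invr_ge0 ?(ltW alpha_gt0)//.
  have <- : 1 `^ alpha = 1 :> R by rewrite powR1.
  by rewrite ge0_ler_powR ?nnegrE ?(ltW alpha_gt0).
(* Only values on [0, 1] enter the equation, so z may be replaced there by a continuous extension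
   u. *)
have sol_Phi z u x : (forall t, unit_itv t -> z t = u t) -> unit_itv x ->
    gtilde alpha c g x + \int[lebesgue_measure]_(t in `[0, x])
      ((x - t) `^ (alpha - 1) * Ktilde alpha k f z t) = Phi u x.
  move=> zu xI; rewrite /Phi /gtilde clamp_id//.
  have tI t : t \in `[0, x]%classic -> unit_itv t.
    move: xI; rewrite /unit_itv inE /= !in_itv/= => /andP[_ x1] /andP[-> tx].
    exact: le_trans x1.
  congr (_ + _ * _ + _); apply: eq_Rintegral => t /tI tu; rewrite /= ?clamp_id//.
  rewrite /K /Ktilde; congr (_ * (_ * _)).
  by apply: eq_Rintegral => s /set_mem sI; rewrite !clamp_id// zu.
have cst0_cont : continuous ((fun=> 0) : R -> R) by move=> x; exact: cvg_cst.
have [C hC] := continuous_bounded_unit (Phi_cont _ cst0_cont).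
have {}hC x : `|Phi (fun=> 0) x| <= C by rewrite -Phi_clamp hC// clamp_itv.
have [y [y_cont y_fix]] :=
  uniform_contraction_fixpoint q_ge0 q_lt1 Phi_cont Phi_lip hC.
exists y; split.
  split; first exact: continuous_subspaceT.
  by move=> x xI; rewrite (sol_Phi y y)// y_fix.
move=> z [z_cont z_sol] x xI.
(* A competing solution is continuous only within [0, 1]; its clamped extension is a continuous
   fixed point of [Phi]. *)
pose w := z \o @clamp R.
have w_cont : continuous w.
  exact: continuous_comp_within cclamp (@unit_itv_clamp R) z_cont.
have w_fix : Phi w =1 w.
  move=> t; rewrite -Phi_clamp -(sol_Phi z w) -?z_sol//; first exact: unit_itv_clamp.
  - by move=> s sI; rewrite /w /= clamp_id.
  - exact: unit_itv_clamp.
have wy_cont : continuous (fun t => w t - y t).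
  by move=> t; apply: cvgB; [exact: w_cont|exact: y_cont].
have [D hD] := continuous_bounded_unit wy_cont.
(* Fixed points of [Phi] factor through [clamp], so the bound on [0, 1] holds on the whole line. *)
have wyD t : `|w t - y t| <= D.
  rewrite -w_fix -y_fix -[Phi w t]Phi_clamp -[Phi y t]Phi_clamp w_fix y_fix.
  by rewrite hD// clamp_itv.
rewrite -(uniform_contraction_unique q_ge0 q_lt1 Phi_lip w_cont y_cont w_fix y_fix wyD).
by rewrite /w /= clamp_id.
Qed.
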